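(* There exist absolute constants $c,C>0$ such that the following holds. Let $p=p(n)$ satisfy $p\gg 1/n$ and $p=o(1)$, let $G\sim G(n,p)$, and write $np=he^{h}$ with $h=h(n)>0$. Then, with high probability, both of the following statements hold. (i) Every $2$-edge-coloring of $G$ contains a monochromatic connected component of order at least $n-Cne^{-h}$. (ii) There exists a $2$-edge-coloring of $G$ such that every monochromatic connected component has order at most $n-cne^{-h}$.
   Context: $G(n,p)$ is the binomial (Erdős–Rényi) random graph on $n$ labelled vertices, each pair being an edge independently with probability $p$. Asymptotics are as $n\to\infty$; $p\gg 1/n$ means $np\to\infty$, and ''with high probability'' means with probability tending to $1$. The number $h=h(n)$ is the unique positive real with $he^h=np$. An $r$-edge-coloring assigns to each edge one of $r$ colors arbitrarily (not necessarily properly). A monochromatic connected component is a connected component of the spanning subgraph formed by all edges of one color; its order is its number of vertices. *)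

(* Defs.v *)
From mathcomp Require Import all_boot all_order all_algebra.
From mathcomp Require Import all_classical all_reals all_analysis.
Set Implicit Arguments.
Unset Strict Implicit.
Unset Printing Implicit Defensive.
Import Order.TTheory GRing.Theory Num.Theory.
Import numFieldNormedType.Exports.
Local Open Scope ring_scope.
Local Open Scope classical_set_scope.

Notation vpair n := {e : {set 'I_n} | #|e| == 2%N}.

(* A simple graph on the vertex set 'I_n, given by its edge set. *)
Notation graph n := {set vpair n}.

Definition gnp_weight (R : realType) (n : nat) (p : R) (G : graph n) : R :=
  \prod_(e : vpair n) (if e \in G then p else 1 - p).

Definition gnp_prob (R : realType) (n : nat) (p : R) (A : graph n -> Prop) : R :=
  \sum_(G : graph n | `[< A G >]) gnp_weight p G.

Lemma gnp_prob_total (R : realType) (n : nat) (p : R) :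
  gnp_prob p (fun _ : graph n => True) = 1.
Proof.
rewrite /gnp_prob (eq_bigl xpredT); last by move=> G; apply/asboolP.
have <- : \prod_(e : vpair n) (p + (1 - p)) = 1.
  by rewrite big1 // => e _; rewrite addrCA subrr addr0.
by rewrite bigA_distr.
Qed.

Definition whp (R : realType) (p : nat -> R)
    (A : forall n : nat, graph n -> Prop) : Prop :=
  gnp_prob (p n) (A n) @[n --> \oo] --> (1 : R).

Definition coloring (r n : nat) (G : graph n) : Type :=
  {ffun {e : vpair n | e \in G} -> 'I_r}.

Definition mono_adj (r n : nat) (G : graph n) (col : coloring r G) (k : 'I_r)
    : rel 'I_n :=
  fun x y => [exists e : {e : vpair n | e \in G},
    (val (val e) == [set x; y]%SET) && (col e == k)].

(* Isolated vertices form singleton components. *)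
Definition components (T : finType) (e : rel T) : {set {set T}} :=
  equivalence_partition (connect e) [set: T]%SET.

Definition mono_component (r n : nat) (G : graph n) (col : coloring r G)
    (S : {set 'I_n}) : Prop :=
  exists k : 'I_r, S \in components (mono_adj col k).

(* Main.v *)
Require Import Defs.
From mathcomp Require Import all_boot all_order all_algebra.
From mathcomp Require Import all_classical all_reals all_analysis.
From mathcomp Require Import zify ring lra.
Import Order.TTheory GRing.Theory Num.Theory.
Import numFieldNormedType.Exports.
Local Open Scope ring_scope.

Set Implicit Arguments.
Unset Strict Implicit.
Unset Printing Implicit Defensive.

(** Put y = n e^{-h}. Since np = h e^h, this is the scale y = h / p, that is,
    up to constants log(np) / p, the order of the largest independent sets of
    G(n,p) and of its largest empty bipartite pairs.

    Lower bound. With s about 4y, a union bound shows that with high probability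
    every two disjoint s-sets are joined by an edge ([gnp_prob_hole_le]): there
    are at most e^{2(sh + y)} pairs of s-sets, and each spans no edge with
    probability at most e^{-p s^2}, which is about e^{-4hs}. The rest is
    deterministic ([large_component]). Colour the edges red and blue. If every red
    component misses more than 3s vertices, the red components can be grouped
    into two sides X and Y of at least 3s vertices each, and all edges between
    X and Y are blue. A union U of blue components then cannot meet X in s
    vertices and miss s vertices of Y, nor the same with X and Y exchanged, so U
    has fewer than s vertices on each side or misses fewer than s on each side.
    Two unions of the first kind never add up to one of the second kind, so some
    single blue component is of the second kind and misses fewer than 2s
    vertices.

    Upper bound. Suppose A and B are disjoint sets with no edge between them.
    Colour the edges that meet A with one colour and all others with the other:
    the vertices of A are isolated in the second colour and those of B in the
    first, so every monochromatic component misses min(|A|, |B|) vertices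
    ([small_mono_components]). For A take any set of about y/4 vertices, and for
    B the vertices outside A without a neighbour in A; the mean size of B is
    about n e^{-p|A|}, well above y, and B is concentrated by Chebyshev's
    inequality ([gnp_prob_few_non_neighbours]).

    Both exceptional events have probability O(1/h), and h tends to infinity
    with np. *)

(** * Components of two-coloured graphs *)

Section Components.
Local Open Scope nat_scope.
Local Open Scope set_scope.

(** A minimal closed set U with property Q contains the component K of
    each of its points. If K lacks Q, then U splits into K and a smaller closed
    set, which lacks Q by minimality. This stands in for adding up components
    one at a time until Q first holds. *)
Lemma component_or_split (T : finType) (e : rel T) (Q : {set T} -> Prop) :
  symmetric e -> Q [set: T] -> ~ Q finset.set0 ->
  (exists2 S, S \in components e & Q S) \/
  exists U1 U2 : {set T}, [/\ fingraph.closed e U1, fingraph.closed e U2,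
    ~ Q U1, ~ Q U2 & Q (U1 :|: U2)].
Proof.
move=> e_sym QT Q0.
pose P (U : {set T}) := `[< fingraph.closed e U /\ Q U >].
have PT : P [set: T] by apply/asboolP; split=> // x y _; rewrite !inE.
case: (arg_minnP (fun U : {set T} => #|U|) PT) => U /asboolP[clU QU] minU.
have [x xU] : exists x, x \in U.
  by apply/set0Pn; apply/eqP=> U0; apply: Q0; rewrite -U0.
pose K : {set T} := [set y in [set: T] | connect e x y].
have clK : fingraph.closed e K.
  move=> y z eyz; rewrite !inE /=.
  exact: (same_connect_r (sym_connect_sym e_sym) (connect1 eyz)).
have KU : K \subset U.
  by apply/fintype.subsetP=> y; rewrite !inE /= => /(closed_connect clU) <-.
case: (pselect (Q K)) => QK.
  by left; exists K => //; apply/imsetP; exists x.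
right; exists K, (U :\: K); split=> //.
- by move=> y z eyz; rewrite !finset.in_setD (clU _ _ eyz) (clK _ _ eyz).
- move=> QD; have /minU : P (U :\: K).
    apply/asboolP; split=> // y z eyz.
    by rewrite !finset.in_setD (clU _ _ eyz) (clK _ _ eyz).
  apply/negP; rewrite -ltnNge; apply: proper_card.
  apply/properP; split; first exact: subsetDl.
  by exists x => //; rewrite !inE connect0.
- suff -> : K :|: U :\: K = U by [].
  by rewrite -{1}(finset.setIidPr KU) finset.setID.
Qed.

Lemma component_closed (T : finType) (e : rel T) (S : {set T}) :
  symmetric e -> S \in components e -> fingraph.closed e S.
Proof.
move=> e_sym /imsetP[x _ ->] y z eyz; rewrite !inE /=.
exact: (same_connect_r (sym_connect_sym e_sym) (connect1 eyz)).
Qed.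

(** The strict bound on Z keeps the singleton components inside Z within the
    conclusion. *)
Lemma card_component_avoiding (T : finType) (e : rel T) (Z S : {set T}) :
  (forall x y, x \in Z -> e x y = false) -> symmetric e -> #|Z| < #|T| ->
  S \in components e -> #|S| <= #|T| - #|Z|.
Proof.
move=> isoZ e_sym ltZ /imsetP[x _ ->].
case: (boolP (x \in Z)) => xZ.
  suff -> : [set y in [set: T] | connect e x y] = [set x].
    by rewrite cards1 subn_gt0.
  apply/setP=> y; rewrite !inE /= eq_sym; apply/idP/idP; last by move/eqP->.
  case/connectP=> -[|z q] /=; first by move=> _ ->.
  by rewrite isoZ.
have clZ : fingraph.closed e (~: Z).
  move=> y z eyz; rewrite !finset.in_setC.
  case: (boolP (y \in Z)) => [/(isoZ _ z)|_]; first by rewrite eyz.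
  by case: (boolP (z \in Z)) => // /(isoZ _ y); rewrite e_sym eyz.
rewrite -(cardsC Z) addKn.
apply/subset_leq_card/fintype.subsetP=> y; rewrite inE => /andP[_ cxy].
by rewrite -(closed_connect clZ cxy) finset.in_setC.
Qed.

Definition edges_between (n : nat) (A B : {set 'I_n}) : {set vpair n} :=
  [set e | [exists x in A, exists y in B, val e == [set x; y]]].

Lemma edges_betweenP (n : nat) (A B : {set 'I_n}) (e : vpair n) :
  reflect (exists x y, [/\ x \in A, y \in B & val e = [set x; y]])
    (e \in edges_between A B).
Proof.
rewrite inE; apply: (iffP existsP) => [[x /andP[xA /existsP[y]]]|[x [y [xA yB exy]]]].
  by move=> /andP[yB /eqP exy]; exists x, y.
by exists x; rewrite xA; apply/existsP; exists y; rewrite yB exy /=.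
Qed.

Definition hole_free (n s : nat) (G : graph n) :=
  forall A B : {set 'I_n}, [disjoint A & B] -> s <= #|A| -> s <= #|B| ->
  ~~ [disjoint edges_between A B & G].

Lemma mono_adjP (r n : nat) (G : graph n) (col : coloring r G) k x y :
  reflect (exists2 e, val (val e) = [set x; y] & col e = k)
    (mono_adj col k x y).
Proof.
apply: (iffP existsP) => [[e /andP[/eqP exy /eqP ek]]|[e exy ek]]; exists e => //.
by rewrite exy ek !eqxx.
Qed.

Lemma mono_adj_sym (r n : nat) (G : graph n) (col : coloring r G) k :
  symmetric (mono_adj col k).
Proof. by move=> x y; apply: eq_existsb => e; rewrite finset.setUC. Qed.

Lemma two_colors (k : 'I_2) : k = ord0 \/ k = ord_max.
Proof. by case: k => -[|[|//]] ?; [left|right]; apply: val_inj. Qed.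

(** The lemma is applied to red with the property of having at least 3s
    elements, which yields either a component missing at most 3s vertices or
    a splitting of the vertex set, and then to blue with the property [big]. *)
Lemma large_component (T : finType) (red blue : rel T) (s : nat) :
  symmetric red -> symmetric blue -> 0 < s -> 9 * s <= #|T| ->
  (forall A B : {set T}, [disjoint A & B] -> s <= #|A| -> s <= #|B| ->
     exists x y, [/\ x \in A, y \in B & red x y || blue x y]) ->
  exists2 S : {set T}, S \in components red \/ S \in components blue &
    #|T| <= #|S| + 3 * s.
Proof.
move=> red_sym blue_sym s_gt0 le_n holeG.
have [[S Sred leS]|[X [clX leX leY]]] :
    (exists2 S, S \in components red & #|T| <= #|S| + 3 * s) \/
    exists X : {set T}, [/\ fingraph.closed red X, 3 * s <= #|X| & 3 * s <= #|~: X|].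
- case: (component_or_split (Q := fun U => 3 * s <= #|U|) red_sym).
  + by rewrite cardsT; lia.
  + by rewrite cards0; lia.
  + move=> [S Scomp leS]; case: (leqP #|T| (#|S| + 3 * s)) => ltS.
      by left; exists S.
    right; exists S; split=> //; first exact: component_closed Scomp.
    by have := cardsC S; lia.
    (* Each part has fewer than 3s elements, so the union has fewer than 6s and
       leaves at least 9s - 6s outside. *)
  + move=> [U1 [U2 [cl1 cl2 lt1 lt2 leU]]]; right; exists (U1 :|: U2); split=> //.
      by move=> x y exy; rewrite !finset.in_setU (cl1 _ _ exy) (cl2 _ _ exy).
    have := cardsC (U1 :|: U2).
    by have := cardsUI U1 U2; lia.
- by exists S; first by left.
set Y := ~: X in leY.
(* No edge joins A to B: red edges stay on one side of X, blue ones in U or in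
   its complement. *)
have cross (U A B : {set T}) : fingraph.closed blue U ->
    A \subset U -> B \subset ~: U ->
    A \subset X /\ B \subset Y \/ A \subset Y /\ B \subset X ->
    s <= #|A| -> #|B| < s.
  move=> clU AU BU ABX leA; rewrite ltnNge; apply/negP=> leB.
  have [|x [y [xA yB /orP[exy|exy]]]] := holeG A B _ leA leB.
  - rewrite -finset.setI_eq0 -finset.subset0.
    apply/fintype.subsetP=> x; rewrite inE => /andP[/(fintype.subsetP AU) xU].
    by move/(fintype.subsetP BU); rewrite inE xU.
  - have := clX _ _ exy.
    case: ABX => -[/fintype.subsetP/(_ x xA) + /fintype.subsetP/(_ y yB)].
      by move=> ->; rewrite inE => /negbTE->.
    by rewrite inE => /negbTE -> ->.
  - have := clU _ _ exy; rewrite (fintype.subsetP AU _ xA).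
    by have := fintype.subsetP BU _ yB; rewrite inE => /negbTE ->.
pose big (U : {set T}) := s <= #|X :&: U| \/ s <= #|Y :&: U|.
have big_cofinite (U : {set T}) : fingraph.closed blue U -> big U ->
    #|X :\: U| < s /\ #|Y :\: U| < s.
  move=> clU bigU.
  have subU (Z : {set T}) : Z :&: U \subset U by exact: subsetIr.
  have subC (Z : {set T}) : Z :\: U \subset ~: U by rewrite finset.setDE subsetIr.
  have cXY := cross U (X :&: U) (Y :\: U) clU (subU _) (subC _)
    (or_introl (conj (subsetIl _ _) (subsetDl _ _))).
  have cYX := cross U (Y :&: U) (X :\: U) clU (subU _) (subC _)
    (or_intror (conj (subsetIl _ _) (subsetDl _ _))).
  have := cardsID U X; have := cardsID U Y.
  by case: bigU => [le1|le2]; [have := cXY le1 | have := cYX le2]; lia.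
case: (component_or_split (Q := big) blue_sym).
- by left; rewrite finset.setIT; lia.
- by case; rewrite finset.setI0 cards0; lia.
- move=> [S Scomp bigS]; exists S; first by right.
  have [ltX ltY] := big_cofinite _ (component_closed blue_sym Scomp) bigS.
  have := cardsID S X; have := cardsID S Y; have := cardsC X.
  have := cardsID X S; rewrite (finset.setIC S) (finset.setDE S) -/Y (finset.setIC S).
  by lia.
move=> [U1 [U2 [cl1 cl2 small1 small2 bigU]]].
have clU : fingraph.closed blue (U1 :|: U2).
  by move=> x y exy; rewrite !finset.in_setU (cl1 _ _ exy) (cl2 _ _ exy).
(* U1 and U2 hold fewer than 2s of the at least 3s elements of X, so their union
   misses more than s of them, against [big_cofinite]. *)
have [ltX _] := big_cofinite _ clU bigU.
have := cardsID (U1 :|: U2) X; rewrite finset.setIUr.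
have := cardsUI (X :&: U1) (X :&: U2).
have : #|X :&: U1| < s by rewrite ltnNge; apply/negP=> ?; apply: small1; left.
have : #|X :&: U2| < s by rewrite ltnNge; apply/negP=> ?; apply: small2; left.
by lia.
Qed.

Lemma large_mono_component (n s : nat) (G : graph n) (col : coloring 2 G) :
  0 < s -> 9 * s <= n -> hole_free s G ->
  exists S, mono_component col S /\ n <= #|S| + 3 * s.
Proof.
move=> s_gt0 le_n holeG.
have [] := large_component (mono_adj_sym col ord0) (mono_adj_sym col ord_max) s_gt0.
- by rewrite card_ord.
- move=> A B dAB leA leB.
  have /pred0Pn[e /andP[]] := holeG A B dAB leA leB.
  move=> /edges_betweenP[x [y [xA yB exy]]] eG; exists x, y; split=> //.
  case: (two_colors (col (Sub e eG))) => ek; apply/orP; [left|right];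
    by apply/mono_adjP; exists (Sub e eG); rewrite ?SubK.
- move=> S Scomp; rewrite card_ord => leS; exists S; split=> //.
  by case: Scomp => Sk; [exists ord0 | exists ord_max].
Qed.

Lemma disjoint_card_lt (T : finType) (A B : {set T}) :
  [disjoint A & B] -> B != finset.set0 -> #|A| < #|T|.
Proof.
move=> dAB; rewrite -card_gt0 => B0.
rewrite -(cardsC A) -addn1 leq_add2l (leq_trans B0) // subset_leq_card //.
by rewrite -finset.disjoints_subset disjoint_sym.
Qed.

(** Edges meeting A get colour 0 and the others colour 1; an edge at a vertex of
    B cannot meet A, hence B is isolated in colour 0, and A is in colour 1. *)
Lemma small_mono_components (n : nat) (G : graph n) (A B : {set 'I_n}) :
  [disjoint A & B] -> A != finset.set0 -> B != finset.set0 ->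
  [disjoint edges_between A B & G] ->
  exists col : coloring 2 G, forall S, mono_component col S ->
    #|S| <= n - minn #|A| #|B|.
Proof.
move=> dAB A0 B0 dG.
exists [ffun e : {e : vpair n | e \in G} =>
  if [disjoint val (val e) & A] then ord_max else ord0 : 'I_2] => S [k].
have ltA := disjoint_card_lt dAB B0.
have ltB : #|B| < #|'I_n| by apply: disjoint_card_lt A0; rewrite disjoint_sym.
set col := (X in mono_adj X).
suff [Z [isoZ ltZ leZ]] : exists Z : {set 'I_n},
    [/\ forall x y, x \in Z -> mono_adj col k x y = false, #|Z| < #|'I_n| &
     minn #|A| #|B| <= #|Z|].
  move=> Sk; apply: leq_trans (leq_sub2l n leZ).
  by have := card_component_avoiding isoZ (mono_adj_sym col k) ltZ Sk; rewrite card_ord.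
have [->|->] := two_colors k; [exists B | exists A]; split=> //;
  rewrite ?geq_minl ?geq_minr // => x y xZ; apply: negbTE; apply/negP=> /mono_adjP[e exy];
  rewrite ffunE exy; case: ifP => //.
- move=> /negbT/pred0Pn[z /andP[]].
  rewrite !inE => /orP[/eqP ->|/eqP ->] yA _.
    by have := disjointFr dAB yA; rewrite xZ.
  have := disjointFl dG (valP e) => /negP; apply; apply/edges_betweenP.
  by exists y, x; split=> //; rewrite exy finset.setUC.
- by move=> /disjointFl/(_ xZ); rewrite !inE eqxx.
Qed.
End Components.

(** * Moments and union bounds in the binomial random graph *)

Lemma gnp_weight_ge0 (R : realType) (n : nat) (p : R) (G : graph n) :
  0 <= p <= 1 -> 0 <= gnp_weight p G.
Proof.
by move=> /andP[p0 p1]; apply: prodr_ge0 => e _; case: ifP => //; rewrite subr_ge0.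
Qed.

Definition gnp_mean (R : realType) (n : nat) (p : R) (X : graph n -> R) : R :=
  \sum_(G : graph n) gnp_weight p G * X G.

Lemma gnp_probE (R : realType) (n : nat) (p : R) (A : graph n -> Prop) :
  gnp_prob p A = gnp_mean p (fun G => `[< A G >]%:R).
Proof.
rewrite /gnp_prob big_mkcond; apply: eq_bigr => G _.
by case: ifP; rewrite ?mulr1 ?mulr0.
Qed.

Lemma gnp_mean_le (R : realType) (n : nat) (p : R) (X Y : graph n -> R) :
  0 <= p <= 1 -> (forall G, X G <= Y G) -> gnp_mean p X <= gnp_mean p Y.
Proof.
by move=> p01 XY; apply: ler_sum => G _; rewrite ler_wpM2l ?gnp_weight_ge0.
Qed.

Lemma gnp_meanD (R : realType) (n : nat) (p : R) (X Y : graph n -> R) :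
  gnp_mean p (fun G => X G + Y G) = gnp_mean p X + gnp_mean p Y.
Proof. by rewrite -big_split; apply: eq_bigr => G _; rewrite mulrDr. Qed.

Lemma gnp_meanZ (R : realType) (n : nat) (p a : R) (X : graph n -> R) :
  gnp_mean p (fun G => a * X G) = a * gnp_mean p X.
Proof. by rewrite /gnp_mean mulr_sumr; apply: eq_bigr => G _; rewrite mulrCA. Qed.

Lemma gnp_mean_sum (R : realType) (n : nat) (p : R) (I : finType) (P : pred I)
    (X : I -> graph n -> R) :
  gnp_mean p (fun G => \sum_(i | P i) X i G) = \sum_(i | P i) gnp_mean p (X i).
Proof.
by rewrite exchange_big; apply: eq_bigr => G _; rewrite mulr_sumr.
Qed.

Lemma gnp_mean1 (R : realType) (n : nat) (p : R) :
  gnp_mean p (fun _ : graph n => 1) = 1.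
Proof.
rewrite -[RHS](gnp_prob_total n p) gnp_probE.
by apply: eq_bigr => G _; rewrite asboolT.
Qed.

Lemma gnp_prob_le1 (R : realType) (n : nat) (p : R) (A : graph n -> Prop) :
  0 <= p <= 1 -> gnp_prob p A <= 1.
Proof.
move=> p01; rewrite gnp_probE -[leRHS](gnp_mean1 n p); apply: gnp_mean_le => // G.
by case: asboolP => _; rewrite ?ler01.
Qed.

Lemma gnp_prob_ge (R : realType) (n : nat) (p : R) (A X Y : graph n -> Prop) :
  0 <= p <= 1 -> (forall G, ~ X G -> ~ Y G -> A G) ->
  1 - gnp_prob p X - gnp_prob p Y <= gnp_prob p A.
Proof.
move=> p01 AXY; rewrite !lerBlDr -[leLHS](gnp_mean1 n p) !gnp_probE -!gnp_meanD.
apply: gnp_mean_le => // G; rewrite -!natrD ler1n.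
case: (asboolP (X G)) => XG; case: (asboolP (Y G)) => YG; rewrite ?addnS //.
by rewrite asboolT //; exact: AXY.
Qed.

Lemma gnp_prob_exists (R : realType) (n : nat) (p : R) (I : finType) (P : pred I)
    (A : I -> graph n -> Prop) :
  0 <= p <= 1 ->
  gnp_prob p (fun G => exists2 i, P i & A i G) <= \sum_(i | P i) gnp_prob p (A i).
Proof.
move=> p01; rewrite gnp_probE.
under eq_bigr do rewrite gnp_probE.
rewrite -gnp_mean_sum; apply: gnp_mean_le => // G.
case: asboolP => [[i Pi Ai]|_]; last by apply: sumr_ge0 => i _; exact: ler0n.
by rewrite (bigD1 i) //= asboolT // lerDl; apply: sumr_ge0 => j _; exact: ler0n.
Qed.

Lemma gnp_markov (R : realType) (n : nat) (p t : R) (X : graph n -> R) :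
  0 <= p <= 1 -> (forall G, 0 <= X G) ->
  t * gnp_prob p (fun G => t <= X G) <= gnp_mean p X.
Proof.
move=> p01 X0; rewrite gnp_probE -gnp_meanZ; apply: gnp_mean_le => // G.
by case: asboolP => [tX|_]; rewrite ?mulr1 // mulr0.
Qed.

(** Expanding the product over all pairs of (weight if present + weight if
    absent), where pairs in F get weight 0 when present. Every estimate on the
    random graph below reduces to this identity. *)
Lemma gnp_mean_disjoint (R : realType) (n : nat) (p : R) (F : {set vpair n}) :
  gnp_mean p (fun G => [disjoint F & G]%:R) = (1 - p) ^+ #|F|.
Proof.
transitivity (\prod_(e : vpair n) ((if e \in F then 0 else p) + (1 - p))).
  rewrite bigA_distr; apply: eq_bigr => G _.
  case: (boolP [disjoint F & G]) => dFG.
    rewrite mulr1; apply: eq_bigr => e _; case: ifP => // eG.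
    by rewrite (disjointFl dFG eG).
  rewrite mulr0; have /pred0Pn[e /andP[/= eF eG]] := dFG.
  by rewrite (bigD1 e) //= eG eF mul0r.
rewrite -prodr_const [RHS]big_mkcond; apply: eq_bigr => e _.
by case: ifP; rewrite ?add0r // addrCA subrr addr0.
Qed.

Lemma card_edges_between (n : nat) (A B : {set 'I_n}) :
  [disjoint A & B] -> #|edges_between A B| = (#|A| * #|B|)%N.
Proof.
move=> dAB; rewrite -cardsX -(card_imset _ val_inj).
have inj : {in finset.setX A B &, injective (fun u => [set u.1; u.2]%SET)}.
  move=> [x y] [x' y']; rewrite !finset.in_setX /= => /andP[xA yB] /andP[x'A y'B] eq_xy.
  have : x \in [set x'; y']%SET by rewrite -eq_xy !inE eqxx.
  have : y \in [set x'; y']%SET by rewrite -eq_xy !inE eqxx orbT.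
  rewrite !inE => /orP[/eqP E|/eqP ->].
    by have := disjointFr dAB x'A; rewrite -E yB.
  move=> /orP[/eqP -> //|/eqP E].
  by have := disjointFr dAB xA; rewrite E y'B.
rewrite -(card_in_imset inj); congr #|pred_of_set _|.
apply/setP=> E; apply/imsetP/imsetP=> [[e /edges_betweenP[x [y [xA yB exy]]] ->]|].
  by exists (x, y) => //; rewrite finset.in_setX xA.
move=> [[x y]]; rewrite finset.in_setX /= => /andP[xA yB] ->.
have xy : #|[set x; y]%SET| == 2.
  by rewrite cards2; case: (x =P y) => // E'; have := disjointFr dAB xA; rewrite E' yB.
by exists (Sub [set x; y]%SET xy); rewrite ?SubK //; apply/edges_betweenP; exists x, y.
Qed.

Lemma gnp_mean_no_edges (R : realType) (n : nat) (p : R) (A B : {set 'I_n}) :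
  [disjoint A & B] ->
  gnp_mean p (fun G => [disjoint edges_between A B & G]%:R) =
  (1 - p) ^+ (#|A| * #|B|).
Proof. by move=> dAB; rewrite gnp_mean_disjoint card_edges_between. Qed.

Lemma subset_of_card (T : finType) (A : {set T}) (s : nat) :
  (s <= #|A|)%N -> exists2 B : {set T}, B \subset A & #|B| = s.
Proof.
move/card_geqP=> [r [uniq_r size_r rA]]; exists [set x in r]%SET.
  by apply/fintype.subsetP=> x; rewrite inE => /rA.
by rewrite cardsE (card_uniqP uniq_r).
Qed.

(** A hole with sides of at least s vertices contains one with sides of exactly
    s vertices, and there are at most C(n, s)^2 of those. *)
Lemma gnp_prob_hole (R : realType) (n s : nat) (p : R) :
  0 <= p <= 1 ->
  gnp_prob p (fun G : graph n => ~ hole_free s G) <=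
  'C(n, s)%:R ^+ 2 * (1 - p) ^+ (s * s).
Proof.
move=> p01.
pose P (u : {set 'I_n} * {set 'I_n}) :=
  [&& [disjoint u.1 & u.2], #|u.1| == s & #|u.2| == s].
pose hole (u : {set 'I_n} * {set 'I_n}) (G : graph n) : Prop :=
  [disjoint edges_between u.1 u.2 & G].
apply: (@le_trans _ _ (gnp_prob p (fun G => exists2 u, P u & hole u G))).
  rewrite !gnp_probE; apply: gnp_mean_le => // G; rewrite ler_nat.
  case: asboolP => // nohole; case: asboolP => // nopair; exfalso.
  apply: nohole => A B dAB /subset_of_card[A' sA cA] /subset_of_card[B' sB cB].
  apply/negP=> dG; apply: nopair; exists (A', B'); rewrite /P /hole /=.
    by rewrite cA cB !eqxx !andbT; apply: disjointWl sA (disjointWr sB dAB).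
  apply: disjointWl dG; apply/fintype.subsetP=> e /edges_betweenP[x [y [xA yB exy]]].
  apply/edges_betweenP; exists x, y; split=> //.
    exact: (fintype.subsetP sA).
  exact: (fintype.subsetP sB).
apply: (le_trans (gnp_prob_exists _ _ p01)).
apply: (@le_trans _ _ (\sum_(u | P u) (1 - p) ^+ (s * s))).
  apply: ler_sum => -[A B] /and3P[/= dAB /eqP cA /eqP cB].
  rewrite gnp_probE -{1}cA -{1}cB -(gnp_mean_no_edges p dAB).
  by apply: gnp_mean_le => // G; rewrite asboolb.
rewrite sumr_const -[leLHS]mulr_natl ler_wpM2r ?exprn_ge0 ?subr_ge0 ?(andP p01).2 //.
rewrite -natrX ler_nat -mulnn.
have cS : #|[set A : {set 'I_n} | #|A| == s]%SET| = 'C(n, s).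
  by rewrite card_draws card_ord.
rewrite -{1}cS -cS -cardsX; apply/subset_leq_card/fintype.subsetP=> -[A B].
by rewrite unfold_in finset.in_setX !inE => /and3P[_ -> ->].
Qed.

(** * Vertices without a neighbour in a given set *)

Definition non_neighbours (n : nat) (A : {set 'I_n}) (G : graph n) : {set 'I_n} :=
  [set v in ~: A | [disjoint edges_between [set v] A & G]]%SET.

Lemma edges_betweenUl (n : nat) (A1 A2 B : {set 'I_n}) :
  edges_between (A1 :|: A2)%SET B = (edges_between A1 B :|: edges_between A2 B)%SET.
Proof.
apply/setP=> e; rewrite finset.in_setU; apply/edges_betweenP/orP.
  move=> [x [y []]]; rewrite finset.in_setU => /orP[] xA yB exy; [left|right];
    by apply/edges_betweenP; exists x, y.
by move=> [] /edges_betweenP[x [y [xA yB exy]]]; exists x, y; split=> //;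
  rewrite finset.in_setU xA ?orbT.
Qed.

Lemma disjoint_non_neighbours (n : nat) (A : {set 'I_n}) (G : graph n) :
  [disjoint edges_between (non_neighbours A G) A & G].
Proof.
apply/pred0P=> e; apply/negP=> /= /andP[/edges_betweenP[x [y [+ yA exy]]] eG].
rewrite inE => /andP[_ /disjointFl/(_ eG)/negP]; apply.
by apply/edges_betweenP; exists x, y; rewrite inE.
Qed.

Lemma disjointUl (T : finType) (A B C : {set T}) :
  [disjoint (A :|: B)%SET & C] = [disjoint A & C] && [disjoint B & C].
Proof. by rewrite -!finset.setI_eq0 finset.setIUl finset.setU_eq0. Qed.

Lemma disjoint_set1 (T : finType) (x : T) (A : {set T}) :
  [disjoint [set x]%SET & A] = (x \notin A).
Proof. by rewrite finset.disjoints_subset finset.sub1set finset.in_setC. Qed.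

Section NonNeighbours.
Variables (R : realType) (n : nat) (p : R) (A : {set 'I_n}).
Hypothesis p01 : 0 <= p <= 1.
Let N (G : graph n) : R := #|non_neighbours A G|%:R.
Let mu : R := #|(~: A)%SET|%:R * (1 - p) ^+ #|A|.
Let miss (v : 'I_n) (G : graph n) : R :=
  [disjoint edges_between [set v]%SET A & G]%:R.

Let N_sum G : N G = \sum_(v in (~: A)%SET) miss v G.
Proof.
rewrite /N -sum1_card natr_sum big_mkcond [RHS]big_mkcond /=.
by apply: eq_bigr => v _; rewrite inE /miss; case: (v \in _) => //=; case: ifP.
Qed.

Lemma mean_non_neighbours : gnp_mean p N = mu.
Proof.
transitivity (\sum_(v in (~: A)%SET) (1 - p) ^+ #|A|).
  rewrite /gnp_mean; under eq_bigr do rewrite N_sum.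
  rewrite -/(gnp_mean p (fun G => \sum_(v in (~: A)%SET) miss v G)) gnp_mean_sum.
  apply: eq_bigr => v; rewrite finset.in_setC => vA.
  by rewrite gnp_mean_no_edges ?disjoint_set1 // cards1 mul1n.
by rewrite sumr_const /mu mulr_natl.
Qed.

(** For distinct v and w the event that neither has a neighbour in A is the
    absence of 2|A| pairs, of probability q^2 with q = (1 - p)^|A|; only the
    diagonal terms v = w, of probability q, exceed q^2. *)
Lemma second_moment_non_neighbours :
  gnp_mean p (fun G => N G ^+ 2) <= mu ^+ 2 + mu.
Proof.
have p1 : 0 <= 1 - p by rewrite subr_ge0 (andP p01).2.
set q := (1 - p) ^+ #|A|; have q0 : 0 <= q by exact: exprn_ge0.
have N2 G : N G ^+ 2 = \sum_(v in (~: A)%SET) \sum_(w in (~: A)%SET)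
    [disjoint edges_between [set v; w]%SET A & G]%:R.
  rewrite N_sum expr2 mulr_suml; apply: eq_bigr => v _.
  rewrite mulr_sumr; apply: eq_bigr => w _.
  by rewrite -natrM mulnb edges_betweenUl disjointUl.
rewrite /gnp_mean; under eq_bigr do rewrite N2.
rewrite -/(gnp_mean p (fun G => \sum_(v in (~: A)%SET) \sum_(w in (~: A)%SET)
    [disjoint edges_between [set v; w]%SET A & G]%:R)) gnp_mean_sum.
have -> : mu ^+ 2 + mu = \sum_(v in (~: A)%SET)
    \sum_(w in (~: A)%SET) (q ^+ 2 + (if w == v then q else 0)).
  under eq_bigr => v vA.
    rewrite big_split /= -big_mkcondr /= sumr_const.
    rewrite (eq_bigl (pred1 v)); last first.
      by move=> w /=; case: eqP => [->|]; rewrite ?andbF // vA.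
    rewrite big_pred1_eq.
    over.
  rewrite sumr_const /mu -/q -[RHS]mulr_natl -[q ^+ 2 *+ _]mulr_natl; ring.
apply: ler_sum => v vA; rewrite gnp_mean_sum; apply: ler_sum => w wA.
rewrite gnp_mean_no_edges; last first.
  by rewrite disjointUl !disjoint_set1 -!finset.in_setC vA.
rewrite cards2 eq_sym; case: eqP => _ /=; rewrite ?mul1n ?addr0.
  by rewrite lerDr exprn_ge0.
by rewrite mulnC exprM.
Qed.

(** Chebyshev's inequality: the variance is at most the mean mu. *)
Lemma gnp_prob_few_non_neighbours :
  0 < mu -> gnp_prob p (fun G => N G < mu / 2) <= 4 / mu.
Proof.
move=> mu0; have t0 : 0 < (mu / 2) ^+ 2 by rewrite exprn_gt0 ?divr_gt0.
have var : gnp_mean p (fun G => (N G - mu) ^+ 2) <= mu.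
  have -> : gnp_mean p (fun G => (N G - mu) ^+ 2) =
      gnp_mean p (fun G => N G ^+ 2 + ((- (mu *+ 2)) * N G + mu ^+ 2 * 1)).
    by apply: eq_bigr => G _; congr (_ * _); ring.
  rewrite !gnp_meanD !gnp_meanZ gnp_mean1 mean_non_neighbours.
  have := second_moment_non_neighbours; lra.
have le1 : gnp_prob p (fun G => N G < mu / 2) <=
    gnp_prob p (fun G => (mu / 2) ^+ 2 <= (N G - mu) ^+ 2).
  rewrite !gnp_probE; apply: gnp_mean_le => // G; rewrite ler_nat.
  case: asboolP => // ltN; rewrite asboolT // -[leRHS]sqrrN ler_sqr ?nnegrE; lra.
have := gnp_markov ((mu / 2) ^+ 2) p01 (fun G => sqr_ge0 (N G - mu)).
rewrite -(ler_pM2l t0) in le1.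
move=> /(le_trans le1)/le_trans/(_ var) le2.
rewrite -(ler_pM2l t0); apply: le_trans le2 _.
by rewrite le_eqVlt; apply/orP; left; apply/eqP; field; rewrite gt_eqF.
Qed.
End NonNeighbours.

(** * Estimates at the scale n e^{-h} *)

(** With x = e^{-h}, a single term of the binomial expansion gives
    C(n, s) x^s <= (1 + x)^n <= e^{nx}. *)
Lemma bin_le_expR (R : realType) (n s : nat) (h : R) :
  'C(n, s)%:R <= expR (s%:R * h + n%:R * expR (- h)).
Proof.
set x := expR (- h); have x0 : 0 <= x by exact: expR_ge0.
rewrite expRD -ler_pdivrMl ?expR_gt0 // -expRN -mulrN.
rewrite [expR (s%:R * _)]expRM_natl -/x; apply: (@le_trans _ _ ((x + 1) ^+ n)).
  case: (leqP s n) => [le_sn|lt_ns]; last first.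
    by rewrite bin_small // mulr0 exprn_ge0 // addr_ge0.
  have ltsn : (s < n.+1)%N by [].
  rewrite exprD1n (bigD1 (Ordinal ltsn)) //= mulr_natr lerDl.
  by apply: sumr_ge0 => i _; rewrite mulrn_wge0 // exprn_ge0.
by rewrite expRM_natl addrC lerXn2r ?nnegrE ?expR_ge0 ?expR_ge1Dx // addr_ge0.
Qed.

Lemma expR_le_onemp (R : realType) (p : R) :
  0 <= p <= 1 / 2 -> expR (- (2 * p)) <= 1 - p.
Proof.
move=> /andP[p0 p_half]; rewrite expRN -[leLHS]div1r ler_pdivrMr ?expR_gt0 //.
by have := expR_ge1Dx (2 * p); nra.
Qed.

Lemma edges_betweenC (n : nat) (A B : {set 'I_n}) :
  edges_between A B = edges_between B A.
Proof.
by apply/setP=> e; apply/edges_betweenP/edges_betweenP=> -[x [y [xA yB exy]]];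
  exists y, x; split=> //; rewrite exy finset.setUC.
Qed.

(** Here y = n e^{-h} is h / p, so y >= 2h as p <= 1/2, and n = y e^h. The value
    44 makes e^h >= 1 + h >= 45, the ratio that leaves room for the 9s vertices
    of [large_component] when s is at most 5y. *)
Lemma xexpx_estimates (R : realType) (n : nat) (p h : R) :
  0 <= p <= 1 / 2 -> 44 <= h -> n%:R * p = h * expR h ->
  [/\ n%:R * expR (- h) * p = h, h <= n%:R * expR (- h) &
      45 * (n%:R * expR (- h)) <= n%:R].
Proof.
move=> /andP[p0 p_half] h44 np; set y := n%:R * expR (- h).
have yp : y * p = h by rewrite /y mulrAC np -mulrA -expRD addrN expR0 mulr1.
have y0 : 0 <= y by rewrite mulr_ge0 ?ler0n ?expR_ge0.
split=> //; first by rewrite -yp ler_piMr //; lra.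
have -> : n%:R = y * expR h by rewrite /y -mulrA -expRD addNr expR0 mulr1.
by rewrite mulrC ler_wpM2l //; have := expR_ge1Dx h; lra.
Qed.

(** Since ps >= 4py = 4h, the exponent 2(sh + y) - p s^2 is at most
    -2hs + s/2, hence at most -h. *)
Lemma gnp_prob_hole_le (R : realType) (n s : nat) (p h : R) :
  0 <= p <= 1 -> 1 <= h -> n%:R * expR (- h) * p = h ->
  4 * (n%:R * expR (- h)) <= s%:R -> (0 < s)%N ->
  gnp_prob p (fun G : graph n => ~ hole_free s G) <= 1 / h.
Proof.
move=> p01; set y := n%:R * expR (- h) => h1 yp le_ys s_gt0.
have /andP[p0 p1] := p01.
apply: le_trans (gnp_prob_hole _ _ p01) _.
have le1 : 'C(n, s)%:R ^+ 2 <= expR (2%:R * (s%:R * h + y)).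
  by rewrite expRM_natl lerXn2r ?nnegrE ?expR_ge0 ?ler0n ?bin_le_expR.
have le2 : (1 - p) ^+ (s * s) <= expR ((s * s)%:R * - p).
  rewrite expRM_natl lerXn2r ?nnegrE ?expR_ge0 ?subr_ge0 //.
  exact: expR_ge1Dx.
apply: (@le_trans _ _ (expR (- h))).
  apply: (le_trans (ler_pM _ _ le1 le2)); rewrite ?exprn_ge0 ?subr_ge0 //.
  rewrite -expRD ler_expR natrM.
  have ps : 4 * h <= s%:R * p.
    by apply: le_trans (ler_wpM2r p0 le_ys); rewrite -mulrA yp.
  have s1 : (1 : R) <= s%:R by rewrite ler1n.
  have sps : s%:R * (4 * h) <= s%:R * (s%:R * p) by rewrite ler_wpM2l ?ler0n.
  have sh : h <= s%:R * h by rewrite ler_peMl //; lra.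
  have ss : s%:R <= s%:R * h by rewrite ler_peMr ?ler0n.
  by lra.
rewrite expRN div1r lef_pV2 ?posrE ?expR_gt0 //; last by lra.
by apply: le_trans (expR_ge1Dx h); lra.
Qed.

(** As 1 - p >= e^{-2p}, a vertex has no neighbour in a given set A of at most
    y/2 other vertices with probability at least e^{-py} = e^{-h}; at least n/2
    vertices lie outside A, so the mean is at least (n/2) e^{-h} = y/2. *)
Lemma gnp_prob_few_non_neighbours_le (R : realType) (n : nat) (p h : R)
    (A : {set 'I_n}) :
  0 <= p <= 1 / 2 -> 44 <= h -> n%:R * p = h * expR h ->
  #|A|%:R <= n%:R * expR (- h) / 2 ->
  gnp_prob p (fun G => #|non_neighbours A G|%:R < n%:R * expR (- h) / 4) <= 8 / h.
Proof.
move=> p_half h44 np; have [] := xexpx_estimates p_half h44 np.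
set y := n%:R * expR (- h) => yp le_hy le_yn leA.
have /andP[p0 p2] := p_half.
have p01 : 0 <= p <= 1 by apply/andP; split=> //; lra.
set m : R := #|(~: A)%SET|%:R * (1 - p) ^+ #|A|.
have cA : #|A|%:R + #|(~: A)%SET|%:R = n%:R :> R.
  by rewrite -natrD cardsC card_ord.
have le_q : expR (- h) <= (1 - p) ^+ #|A|.
  apply: (@le_trans _ _ (expR (#|A|%:R * - (2 * p)))).
    rewrite ler_expR; have := ler_wpM2r p0 leA; rewrite mulrAC yp; lra.
  rewrite expRM_natl lerXn2r ?nnegrE ?expR_ge0 ?expR_le_onemp //; lra.
have le_m : y / 2 <= m.
  have -> : y / 2 = n%:R / 2 * expR (- h) by rewrite /y mulrAC.
  apply: ler_pM le_q; rewrite ?divr_ge0 ?ler0n ?expR_ge0 //.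
  by lra.
have m0 : 0 < m by lra.
apply: (@le_trans _ _ (4 / m)).
  apply: le_trans (gnp_prob_few_non_neighbours p01 m0).
  rewrite !gnp_probE; apply: gnp_mean_le => // G; rewrite ler_nat.
  by case: asboolP => // ltN; rewrite asboolT // -/m; lra.
rewrite ler_pdivrMr // mulrAC ler_pdivlMr; last by lra.
by lra.
Qed.

(** The integers s and a are the least above 4y and y/4; as y >= 44 the rounding
    costs little, so 3s <= 15y and a <= y/2. *)
Lemma gnp_prob_extremal_colorings (R : realType) (n : nat) (p h : R) :
  0 <= p <= 1 / 2 -> 44 <= h -> n%:R * p = h * expR h ->
  1 - 9 / h <= gnp_prob p (fun G : graph n =>
      (forall col : coloring 2 G, exists S : {set 'I_n},
         mono_component col S /\
         n%:R - 15 * n%:R * expR (- h) <= #|S|%:R) /\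
      (exists col : coloring 2 G, forall S : {set 'I_n},
         mono_component col S ->
         #|S|%:R <= n%:R - 1 / 4 * n%:R * expR (- h))).
Proof.
move=> p_half h44 np; have [] := xexpx_estimates p_half h44 np.
rewrite -!(mulrA _ n%:R); set y := n%:R * expR (- h) => yp le_hy le_yn.
have p01 : 0 <= p <= 1.
  by have /andP[p0 p2] := p_half; apply/andP; split=> //; lra.
pose s := (Num.trunc (4 * y)).+1.
have lt_s : 4 * y < s%:R by exact: truncnS_gt.
have le_s : s%:R <= 4 * y + 1 by rewrite /s -natr1 lerD2r truncn_le; lra.
pose a := (Num.trunc (y / 4)).+1.
have lt_a : y / 4 < a%:R by exact: truncnS_gt.
have le_a : a%:R <= y / 4 + 1 by rewrite /a -natr1 lerD2r truncn_le; lra.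
have [A _ cA] : exists2 A : {set 'I_n}, A \subset [set: 'I_n]%SET & #|A| = a.
  by apply: subset_of_card; rewrite cardsT card_ord -(ler_nat R); lra.
have le_A : #|A|%:R <= y / 2 by rewrite cA; lra.
apply: le_trans (gnp_prob_ge (X := fun G => ~ hole_free s G)
  (Y := fun G => #|non_neighbours A G|%:R < y / 4) p01 _).
  have h1 : 1 <= h by lra.
  have := gnp_prob_hole_le p01 h1 yp (ltW lt_s) isT.
  have := gnp_prob_few_non_neighbours_le p_half h44 np le_A; rewrite -/y.
  have -> : 9 / h = 1 / h + 8 / h by rewrite -mulrDl; congr (_ / _); ring.
  by lra.
move=> G /contrapT holeG /negP; rewrite -leNgt => leB.
split=> [col|].
  have [] := large_mono_component col _ _ holeG; rewrite ?ltn0Sn //.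
    by rewrite -(ler_nat R) natrM; lra.
  move=> S [Smono leS]; exists S; split=> //.
  by move: leS; rewrite -(ler_nat R) natrD natrM; lra.
have dAB : [disjoint A & non_neighbours A G].
  rewrite disjoint_sym finset.disjoints_subset; apply/fintype.subsetP=> v.
  by rewrite inE => /andP[].
have [] := small_mono_components (G := G) dAB.
- by rewrite -card_gt0 cA.
- by rewrite -card_gt0 -(ltr_nat R); lra.
- by rewrite edges_betweenC; exact: disjoint_non_neighbours.
move=> col leS; exists col => S /leS.
rewrite -(ler_nat R) natrB; last first.
  by rewrite (leq_trans (geq_minl _ _)) // -[leqRHS]card_ord max_card.
have le_min : y / 4 <= (minn #|A| #|non_neighbours A G|)%:R.
  by rewrite /minn; case: ifP => _ //; rewrite cA ltW.
by lra.
Qed.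

(** If h stayed below M then np = h e^h would stay below M e^M. *)
Lemma xexpx_eventually_ge (R : realType) (p h : nat -> R) :
  (n%:R * p n @[n --> \oo] --> +oo)%classic ->
  (\forall n \near \oo, 0 < h n /\ n%:R * p n = h n * expR (h n))%classic ->
  forall M : R, (\forall n \near \oo, M <= h n)%classic.
Proof.
move=> /cvgryPgt np_oo nph M.
near=> n.
have [h0 np] : 0 < h n /\ n%:R * p n = h n * expR (h n) by near: n.
rewrite leNgt; apply/negP=> ltM.
have : M * expR M < n%:R * p n by near: n; exact: np_oo.
rewrite np; apply/negP; rewrite -leNgt.
by apply: ler_pM; rewrite ?expR_ge0 ?ler_expR // ltW.
Unshelve. all: by end_near. Qed.

Local Open Scope classical_set_scope.

Theorem theorem1p2 (R : realType) :
  exists c C : R, 0 < c /\ 0 < C /\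
  forall p h : nat -> R,
    (forall n, 0 <= p n <= 1) ->
    (n%:R * p n @[n --> \oo] --> +oo) ->
    (p n @[n --> \oo] --> (0 : R)) ->
    (\forall n \near \oo, 0 < h n /\ n%:R * p n = h n * expR (h n)) ->
    whp p (fun n (G : graph n) =>
      (forall col : coloring 2 G, exists S : {set 'I_n},
         mono_component col S /\
         n%:R - C * n%:R * expR (- h n) <= #|S|%:R) /\
      (exists col : coloring 2 G, forall S : {set 'I_n},
         mono_component col S ->
         #|S|%:R <= n%:R - c * n%:R * expR (- h n))).
Proof.
exists (1 / 4), 15; split; first by lra.
split; first by lra.
move=> p h p01 np_oo p_0 nph; apply/cvgrPdist_le => eps eps0.
have h_oo := xexpx_eventually_ge np_oo nph.
near=> n.
have [_ np] : 0 < h n /\ n%:R * p n = h n * expR (h n) by near: n.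
have h44 : 44 <= h n by near: n; exact: h_oo.
have heps : 9 / eps <= h n by near: n; exact: h_oo.
have p_half : 0 <= p n <= 1 / 2.
  have /andP[-> _] /= := p01 n.
  by near: n; apply: (cvgr_le (0 : R) p_0); lra.
have le1 := gnp_prob_le1 (fun G : graph n =>
  (forall col : coloring 2 G, exists S : {set 'I_n},
     mono_component col S /\
     n%:R - 15 * n%:R * expR (- h n) <= #|S|%:R) /\
  (exists col : coloring 2 G, forall S : {set 'I_n},
     mono_component col S ->
     #|S|%:R <= n%:R - 1 / 4 * n%:R * expR (- h n))) (p01 n).
have le2 := gnp_prob_extremal_colorings p_half h44 np.
rewrite ger0_norm ?subr_ge0 // lerBlDr addrC -lerBlDr; apply: le_trans le2.
rewrite lerD2l lerN2 ler_pdivrMr; last by lra.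
by rewrite mulrC -ler_pdivrMr.
Unshelve. all: by end_near. Qed.
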